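(* Let $n\ge 2$, let $F\subset\mathbb{R}^n$ be a compact convex set with $\mathbf{0}\in\mathbb{R}^n$ in its interior, and let $\xi\in\partial F$. Assume that there are $\delta>0$ and $f:\mathbb{R}^n\to\mathbb{R}$ of class $C^2$ on $\xi+\delta\mathbf{B}$ such that $F\subset\{x\in\mathbb{R}^n: f(x)\le 0\}$, $\langle \xi,\nabla f(\xi)\rangle>0$, and such that, for $x\in\xi+\delta\mathbf{B}$, we have $x\in\partial F$ if and only if $f(x)=0$. Let $i$ be the first index in $I=\{1,\dots,n\}$ with $f_{x_i}(\xi)\neq 0$. Then $$\hat\gamma_F(\xi,u^j(\xi))=\frac{1}{2\langle\xi,\nabla f(\xi)\rangle\,\|u^j(\xi)\|^2}\,\langle\nabla^2 f(\xi)u^j(\xi),u^j(\xi)\rangle,\qquad j\in I\setminus\{i\}.$$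
   Context: $\langle\cdot,\cdot\rangle$ and $\|\cdot\|$ are the usual inner product and norm of $\mathbb{R}^n$, $\mathbf{B}$ is the open unit ball, $f_{x_k}=\partial f/\partial x_k$, and $\nabla^2 f(\xi)$ is the $n\times n$ Hessian matrix. All points $\eta$ below are taken close enough to $\xi$ that $\langle\eta,\nabla f(\eta)\rangle>0$ and $f_{x_i}(\eta)\ne0$ (possible by continuity). For $\eta\in\partial F$ near $\xi$: - $\eta^*:=\frac{1}{\langle\eta,\nabla f(\eta)\rangle}\nabla f(\eta)$. - For $j\in I\setminus\{i\}$, $u^j(\eta)\in\mathbb{R}^n$ is the vector with $1$ in the $j$th coordinate, $-\frac{f_{x_j}(\eta)}{f_{x_i}(\eta)}$ in the $i$th coordinate and $0$ in the others. - For $u\neq\mathbf 0$ with $\langle u,\nabla f(\eta)\rangle=0$, $P(\eta,u):=\eta+\operatorname{span}\{\nabla f(\eta),u\}$. - For $r>0$, $\widehat{\mathfrak C}_F(r,\eta,u):=\inf\{\langle\eta-y,\eta^*\rangle: y\in F\cap P(\eta,u),\ \|\eta-y\|\ge r\}$ (with $\inf\emptyset=+\infty$). Finally, for $j\in I\setminus\{i\}$, $$\hat\gamma_F(\xi,u^j(\xi)):=\liminf_{(r,\eta)\to(0^+,\xi),\ \eta\in\partial F}\frac{\widehat{\mathfrak C}_F(r,\eta,u^j(\eta))}{r^2}.$$ *)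

(* Defs.v *)
(* R^n is ['rV[R]_n]; its library topology is the usual
   one, but its library norm is the sup norm, hence [dot] and [enorm]. *)
From HB Require Import structures.
From mathcomp Require Import all_boot all_order all_algebra.
From mathcomp Require Import all_classical all_reals all_analysis.

Set Implicit Arguments.
Unset Strict Implicit.
Unset Printing Implicit Defensive.

Import Order.TTheory GRing.Theory Num.Theory.
Import numFieldNormedType.Exports.

Local Open Scope classical_set_scope.
Local Open Scope ring_scope.

Section Defs.
Context {R : realType} {n : nat}.
Implicit Types (x y u v eta : 'rV[R]_n) (F U : set 'rV[R]_n).
Implicit Types (f : 'rV[R]_n -> R).

Definition dot u v : R := \sum_(k < n) u 0 k * v 0 k.

Definition enorm u : R := Num.sqrt (dot u u).

Definition eball x (d : R) : set 'rV[R]_n := [set y | enorm (y - x) < d].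

Definition boundary F : set 'rV[R]_n := closure F `\` interior F.

Definition partial f (k : 'I_n) : 'rV[R]_n -> R :=
  fun x => 'D_(delta_mx 0 k) f x.

Definition grad f x : 'rV[R]_n := \row_k partial f k x.

Definition hessian f x : 'M[R]_n :=
  \matrix_(k, l) partial (partial f l) k x.

(* Meant for open [U]: continuity is that of [f] on the whole space at the
   points of [U]. *)
Definition C1_on U f : Prop :=
  forall x, U x -> {for x, continuous f} /\
    forall k : 'I_n, derivable f x (delta_mx 0 k) /\
                     {for x, continuous (partial f k)}.

Definition C2_on U f : Prop :=
  C1_on U f /\ forall k : 'I_n, C1_on U (partial f k).

(* The vector eta^*. *)
Definition star f eta : 'rV[R]_n := (dot eta (grad f eta))^-1 *: grad f eta.

Definition uvec f (i j : 'I_n) eta : 'rV[R]_n :=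
  \row_k (if k == j then 1
          else if k == i then - (partial f j eta / partial f i eta)
          else 0).

(* P(eta, u) = eta + span {grad f(eta), u}. *)
Definition plane f eta u : set 'rV[R]_n :=
  [set y | y - eta \in <<[:: grad f eta; u]>>%VS].

(* [ereal_inf set0 = +oo]. *)
Definition Chat F f (r : R) eta u : \bar R :=
  ereal_inf [set (dot (eta - y) (star f eta))%:E |
              y in [set y | [/\ F y, plane f eta u y & r <= enorm (eta - y)]]].

(* The points eta = xi are allowed in the lower limit, whereas r > 0.
   [Chat], [star] and [uvec] take junk values where a denominator vanishes,
   but the lower limit only depends on eta close to xi. *)
Definition gammahat F f (i j : 'I_n) (xi : 'rV[R]_n) : \bar R :=
  limf_einf
    (fun p : R * 'rV[R]_n =>
       (Chat F f p.1 p.2 (uvec f i j p.2) / (p.1 ^+ 2)%:E)%E)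
    (filter_prod (0 : R)^'+ (within (boundary F) (nbhs xi))).

End Defs.

(* Main.v *)
Require Import Defs.
From HB Require Import structures.
From mathcomp Require Import all_boot all_order all_algebra.
From mathcomp Require Import all_classical all_reals all_analysis.
From mathcomp Require Import ring lra.

Set Implicit Arguments.
Unset Strict Implicit.
Unset Printing Implicit Defensive.

Import Order.TTheory GRing.Theory Num.Theory.
Import numFieldNormedType.Exports.

Local Open Scope classical_set_scope.
Local Open Scope ring_scope.

(** Fix a boundary point [eta] near [xi], with [f eta = 0], write [g] for
    [grad f eta], [u] for [uvec f i j eta], which is orthogonal to [g], [D] for
    the inner product of [eta] and [g], and [Q] for the quadratic form of the
    Hessian of [f] at [xi].  For [y = eta + h], the quantity minimized in [Chat]
    is [T / D] with [T = - dot g h].  Since [f] is of class C^2, the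
    approximation [f (eta + h) = dot g h + Q h / 2 + o(|h|^2)] is uniform for
    [eta] near [xi] ([taylor2]).

    Lower bound.  If [y] is in [F], then [f y <= 0], so [T] is at least
    [Q h / 2] up to [o(|h|^2)].  If moreover [y] is in the plane of [g] and [u],
    then [h = a g + b u]; either [T], which is proportional to [-a], is large
    compared with [|h|^2], or [h] is almost parallel to [u] and
    [Q h = |h|^2 Q u / |u|^2 + o(|h|^2)].  The inequality
    [plane_curvature_ineq] covers both cases at once, and convexity of [F]
    reduces the points with [|h| >= r] to those with [|h| = r].  This gives
    [Chat >= r^2 * curvature_bound] ([Chat_ge]), where [curvature_bound] is an
    explicit continuous function of [r] and [eta] whose value at [(0, xi)] is
    the claimed limit, up to an arbitrarily small error.

    Upper bound.  It is enough to take [eta = xi].  Along the parabola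
    [b |-> xi + b u - c b^2 g] the quotient of [f] by [b^2] tends to
    [Q u / 2 - c |g|^2] ([parabola_limit]), so for small [b] the sign of [f]
    changes when [c] crosses a small interval around [Q u / (2 |g|^2)].  The
    intermediate value theorem yields a zero of [f] there, which is a boundary
    point of [F], hence a point of [F], at distance at least [b |u|] from [xi]
    ([Chat_le]). *)

(** * The Euclidean inner product *)

Section DotProduct.
Context {R : realType} {n : nat}.
Implicit Types u v w : 'rV[R]_n.

Lemma dotC u v : dot u v = dot v u.
Proof. by apply: eq_bigr => k _; rewrite mulrC. Qed.

Lemma dotDl u v w : dot (u + v) w = dot u w + dot v w.
Proof. by rewrite -big_split; apply: eq_bigr => k _; rewrite mxE mulrDl. Qed.

Lemma dotZl a u w : dot (a *: u) w = a * dot u w.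
Proof. by rewrite mulr_sumr; apply: eq_bigr => k _; rewrite mxE mulrA. Qed.

Lemma dotDr u v w : dot w (u + v) = dot w u + dot w v.
Proof. by rewrite !(dotC w) dotDl. Qed.

Lemma dotZr a u w : dot w (a *: u) = a * dot w u.
Proof. by rewrite !(dotC w) dotZl. Qed.

Lemma dotBl u v w : dot (u - v) w = dot u w - dot v w.
Proof. by rewrite -scaleN1r dotDl dotZl mulN1r. Qed.

Lemma dot_ge0 u : 0 <= dot u u.
Proof. by apply: sumr_ge0 => k _; rewrite -expr2 sqr_ge0. Qed.

Lemma enorm_ge0 u : 0 <= enorm u. Proof. exact: sqrtr_ge0. Qed.

Lemma sqr_enorm u : enorm u ^+ 2 = dot u u.
Proof. by rewrite sqr_sqrtr ?dot_ge0. Qed.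

Lemma enormZ a u : enorm (a *: u) = `|a| * enorm u.
Proof.
by rewrite /enorm dotZl dotZr mulrA -expr2 sqrtrM ?sqr_ge0 // sqrtr_sqr.
Qed.

Lemma enormN u : enorm (- u) = enorm u.
Proof. by rewrite -scaleN1r enormZ normrN1 mul1r. Qed.

Lemma coord_le_norm u k : `|u 0 k| <= `|u|.
Proof.
rewrite {2}/Num.norm /= mx_normrE; apply: le_trans (le_bigmax _ _ (0, k)).
by [].
Qed.

Lemma sqr_coord_le_dot u k : u 0 k ^+ 2 <= dot u u.
Proof.
rewrite /dot (bigD1 k) //= -expr2 lerDl.
by apply: sumr_ge0 => l _; rewrite -expr2 sqr_ge0.
Qed.

Lemma norm_le_enorm u : `|u| <= enorm u.
Proof.
rewrite [leLHS](_ : _ = mx_norm u) //.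
have [->|/mx_norm_neq0[[i k] /= ->]] := eqVneq (mx_norm u) 0.
  exact: enorm_ge0.
by rewrite ord1 -sqrtr_sqr ler_wsqrtr // sqr_coord_le_dot.
Qed.

Lemma norm_lt_coord u r :
  0 < r -> (forall k, `|u 0 k| < r) -> `|u| < r.
Proof.
move=> r0 ur; rewrite [ltLHS](_ : _ = mx_norm u) //.
have [->//|/mx_norm_neq0[[i k] /= ->]] := eqVneq (mx_norm u) 0.
by rewrite ord1.
Qed.

Lemma cvg_sum (T : Type) (G : set_system T) {FG : Filter G} (m : nat)
    (p : 'I_m -> T -> R) (l : 'I_m -> R) :
  (forall k, p k x @[x --> G] --> l k) ->
  \sum_k p k x @[x --> G] --> \sum_k l k.
Proof.
move=> pl; elim: (index_enum _) => [|k s IHs].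
  by rewrite big_nil; under eq_fun do rewrite big_nil; exact: cvg_cst.
by rewrite big_cons; under eq_fun do rewrite big_cons; exact: cvgD.
Qed.

Lemma cvg_dot (T : Type) (G : set_system T) {FG : Filter G}
    (p q : T -> 'rV[R]_n) u v :
  (forall k, p x 0 k @[x --> G] --> u 0 k) ->
  (forall k, q x 0 k @[x --> G] --> v 0 k) ->
  dot (p x) (q x) @[x --> G] --> dot u v.
Proof. by move=> pu qv; apply: cvg_sum => k; apply: cvgM. Qed.

Lemma cvg_coord u k : x 0 k @[x --> u] --> u 0 k.
Proof. exact: coord_continuous. Qed.

Lemma nbhs_eball (x : 'rV[R]_n) d : 0 < d -> nbhs x (eball x d).
Proof.
move=> d0; have : dot (y - x) (y - x) @[y --> x] --> dot (x - x) (x - x).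
  by apply: (@cvg_dot _ (nbhs x)) => k;
    under eq_fun do rewrite !mxE; rewrite !mxE;
    apply: cvgB; [exact: cvg_coord|exact: cvg_cst|
                  exact: cvg_coord|exact: cvg_cst].
rewrite subrr [X in _ --> X](_ : _ = 0); last first.
  by rewrite -(scale0r 0) dotZl mul0r.
move=> /cvgrPdist_lt.
move=> /(_ (d ^+ 2)); rewrite exprn_gt0 // => /(_ isT); apply: filterS => y.
rewrite sub0r normrN ger0_norm ?dot_ge0 // => yd.
by rewrite /eball /= -(ger0_norm (ltW d0)) -sqrtr_sqr ltr_sqrt ?exprn_gt0.
Qed.

End DotProduct.

(** * Functions with continuous partial derivatives *)

Section Calculus.
Context {R : realType} {n : nat}.
Implicit Types (x y h : 'rV[R]_n) (f : 'rV[R]_n -> R).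

(** The bound is asked on both sides of [0] because the sign of [d] is
    arbitrary. *)
Lemma mvt_affine (g dg : R -> R) (c e d : R) :
  (forall s : R, `|s| <= `|d| -> is_derive s (1 : R) g (dg s)) ->
  (forall s, `|s| <= `|d| -> `|dg s - c| <= e) ->
  `|g d - g 0 - c * d| <= e * `|d|.
Proof.
move=> dgE dgc.
have cg s : `|s| <= `|d| -> {for s, continuous g}.
  move=> /dgE gs; apply: differentiable_continuous.
  by apply/derivable1_diffP; case: gs.
have [d0|d0] := leP 0 d.
  have I s : s \in `[0, d] -> `|s| <= `|d|.
    by rewrite in_itv /= => /andP[s0 sd]; rewrite !ger0_norm.
  have [|s|s sI ->] := @MVT_segment R g dg 0 d d0.
  - by move=> s /subset_itv_oo_cc /I; exact: dgE.
  - by apply: continuous_in_subspaceT => t; rewrite inE => /I /cg.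
  by rewrite subr0 -mulrBl normrM ler_wpM2r // dgc // I.
have I s : s \in `[d, 0] -> `|s| <= `|d|.
  rewrite in_itv /= => /andP[s0 sd]; rewrite !ler0_norm ?lerN2 //.
  exact: ltW.
have [|s|s sI E] := @MVT_segment R g dg d 0 (ltW d0).
- by move=> s /subset_itv_oo_cc /I; exact: dgE.
- by apply: continuous_in_subspaceT => t; rewrite inE => /I /cg.
rewrite -[g d - g 0]opprB E sub0r mulrN opprK -mulrBl normrM.
by rewrite ler_wpM2r // dgc // I.
Qed.

Lemma is_derive_line f x h t a :
  is_derive (x + t *: h) h f a ->
  is_derive t (1 : R) (fun s => f (x + s *: h)) a.
Proof.
case=> fd <-.
have E : (fun k => k^-1 *: (f (x + (k *: (1 : R) + t) *: h) - f (x + t *: h)))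
   = (fun k => k^-1 *: (f (k *: h + (x + t *: h)) - f (x + t *: h))).
  by apply/funext => k; rewrite scalerDl [_ *: (1 : R)]mulr1 addrCA.
by split; rewrite /derivable /derive /= E.
Qed.

(** Continuous partial derivatives give strict differentiability, which is
    differentiability uniform in the base point.  From [x] to [y] the
    coordinates are changed one at a time, and each step is a mean value
    estimate along a coordinate axis. *)
Lemma C1_strict_derivative (U : set 'rV[R]_n) f x0 : nbhs x0 U -> C1_on U f ->
  forall e, 0 < e -> exists2 r, 0 < r & forall x y,
    `|x - x0| < r -> `|y - x0| < r ->
    `|f y - f x - dot (grad f x0) (y - x)| <= e * `|y - x|.
Proof.
move=> Ux0 fC1 e e0; have [_ fx0] := fC1 _ (nbhs_singleton Ux0).
pose e' := e / n.+1%:R; have e'0 : 0 < e' by rewrite divr_gt0.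
have : \forall z \near x0,
    U z /\ forall k, `|partial f k z - partial f k x0| <= e'.
  apply: filterI => //; apply: (@filter_forall _ _
    (fun k z => `|partial f k z - partial f k x0| <= e') (nbhs x0)) => k.
  exact: (cvgrPdistC_le _ _).1 (fx0 k).2 _ e'0.
case/nbhs_normP => r0 r00 r0P.
(* The estimate of [mvt_affine] at step [k] involves the points whose
   coordinate [k] is within [|y_k - x_k|] of [x_k], hence within
   [r0 / 3 + 2 r0 / 3] of that of [x0]. *)
exists (r0 / 3); first by rewrite divr_gt0.
move=> x y xr yr.
pose z m : 'rV[R]_n := \row_k (if (k < m)%N then y 0 k else x 0 k).
have z0 : z 0%N = x by apply/rowP => k; rewrite mxE.
have zn : z n = y by apply/rowP => k; rewrite mxE ltn_ord.
have -> : f y - f x - dot (grad f x0) (y - x) = \sum_(k < n)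
    (f (z k.+1) - f (z k) - partial f k x0 * (y - x) 0 k).
  rewrite sumrB -(big_mkord xpredT (fun k => f (z k.+1) - f (z k))).
  rewrite telescope_sumr // z0 zn; congr (_ - _).
  by apply: eq_bigr => k _; rewrite mxE.
have step (k : 'I_n) :
    `|f (z k.+1) - f (z k) - partial f k x0 * (y - x) 0 k|
      <= e' * `|(y - x) 0 k|.
  have zS : z k.+1 = z k + (y - x) 0 k *: delta_mx 0 k.
    apply/rowP => l; rewrite !mxE ltnS leq_eqVlt /=.
    have [->|lk] := eqVneq l k; first by rewrite eqxx ltnn mulr1 subrKC.
    by rewrite (negPf (_ : (l : nat) != k)) // mulr0 addr0.
  pose g s := f (z k + s *: delta_mx 0 k).
  have zr s : `|s| <= `|(y - x) 0 k| -> `|x0 - (z k + s *: delta_mx 0 k)| < r0.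
    move=> sk; apply: norm_lt_coord => // l; rewrite !mxE /=.
    have xl := le_lt_trans (coord_le_norm _ l) xr.
    have yl := le_lt_trans (coord_le_norm _ l) yr.
    move: xl yl sk; rewrite !mxE.
    have [->|lk] := eqVneq l k.
      rewrite ltnn mulr1 => xl yl sk.
      have -> : x0 0 k - (x 0 k + s) = - (x 0 k - x0 0 k) - s.
        by rewrite opprB opprD addrA.
      apply: le_lt_trans (ler_normB _ _) _; rewrite normrN.
      apply: le_lt_trans (lerD (lexx _) sk) _.
      have -> : y 0 k - x 0 k = (y 0 k - x0 0 k) - (x 0 k - x0 0 k).
        by rewrite opprB addrA subrK.
      apply: le_lt_trans (lerD (lexx _) (ler_normB _ _)) _.
      rewrite [ltRHS](_ : _ = r0 / 3 + (r0 / 3 + r0 / 3)) ?ltrD //.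
      by field.
    rewrite mulr0 addr0 => xl yl _; rewrite distrC.
    apply: (@lt_trans _ _ (r0 / 3)); first by case: ifP.
    by rewrite ltr_pdivrMr // ltr_pMr // ltr1n.
  have := @mvt_affine g
    (fun s => partial f k (z k + s *: delta_mx 0 k)) (partial f k x0) e'
    ((y - x) 0 k).
  rewrite /g scale0r addr0 -zS; apply => s /zr /r0P[Uz zk]; last exact: zk.
  apply: is_derive_line; apply: derivableP.
  by have [_ /(_ k)[]] := fC1 _ Uz.
apply: le_trans (ler_norm_sum _ _ _) _.
apply: (@le_trans _ _ (\sum_(k < n) e' * `|y - x|)).
  apply: ler_sum => k _; apply: le_trans (step k) _.
  by rewrite ler_pM2l // coord_le_norm.
rewrite sumr_const card_ord -mulrnAl ler_wpM2r //.
by rewrite -mulr_natr /e' -mulrA ger_pMr // mulrC ler_pdivrMr // mul1r ler_nat.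
Qed.

Lemma C1_is_derive (U : set 'rV[R]_n) f x h : nbhs x U -> C1_on U f ->
  is_derive x h f (dot (grad f x) h).
Proof.
move=> Ux fC1; suff D : k^-1 *: (f (k *: h + x) - f x) @[k --> 0^'] -->
    dot (grad f x) h.
  by split; [apply: cvgP D|exact: cvg_lim D].
apply/cvgrPdistC_le => e e0.
have e'0 : 0 < e / (`|h| + 1) by rewrite divr_gt0 // ltr_pwDr.
have [r r0 rP] := C1_strict_derivative Ux fC1 e'0.
have r'0 : 0 < r / (`|h| + 1) by rewrite divr_gt0 // ltr_pwDr.
have h1 : `|h| / (`|h| + 1) <= 1.
  by rewrite ler_pdivrMr ?ltr_pwDr // mul1r lerDl.
near=> k.
have k0 : k != 0 by near: k; exact: nbhs_dnbhs_neq.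
have kr : `|k| < r / (`|h| + 1).
  near: k; exact: dnbhs0_lt.
have := rP x (k *: h + x).
rewrite subrr normr0 addrK normrZ => /(_ r0).
have -> : `|k| * `|h| < r.
  apply: (@le_lt_trans _ _ (`|k| * (`|h| + 1))).
    by rewrite ler_wpM2l // lerDl.
  by rewrite -ltr_pdivlMr // ltr_pwDr.
move=> /(_ isT); rewrite dotZr => H.
have -> : k^-1 *: (f (k *: h + x) - f x) - dot (grad f x) h =
    k^-1 * (f (k *: h + x) - f x - k * dot (grad f x) h).
  by rewrite [in RHS]mulrBr mulKf.
rewrite normrM normfV ler_pdivrMl ?normr_gt0 //.
apply: le_trans H _; rewrite mulrC -mulrA ler_wpM2l // mulrCA ger_pMr //.
Unshelve. all: by end_near.
Qed.

End Calculus.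

(** * The second order Taylor formula *)

Section SecondOrder.
Context {R : realType} {n : nat}.
Implicit Types (x y h : 'rV[R]_n) (f : 'rV[R]_n -> R).

Definition quad (H : 'M[R]_n) v w : R := dot (v *m H^T) w.

Lemma quadDl H u v w : quad H (u + v) w = quad H u w + quad H v w.
Proof. by rewrite /quad mulmxDl dotDl. Qed.

Lemma quadZl H a u w : quad H (a *: u) w = a * quad H u w.
Proof. by rewrite /quad -scalemxAl dotZl. Qed.

Lemma quadDr H u v w : quad H w (u + v) = quad H w u + quad H w v.
Proof. exact: dotDr. Qed.

Lemma quadZr H a u w : quad H w (a *: u) = a * quad H w u.
Proof. exact: dotZr. Qed.

Lemma quad_hessianE f x h :
  quad (hessian f x) h h = \sum_l h 0 l * dot (grad (partial f l) x) h.
Proof.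
transitivity (\sum_k \sum_l h 0 l * (partial (partial f l) k x * h 0 k)).
  apply: eq_bigr => k _; rewrite mxE mulr_suml.
  by apply: eq_bigr => l _; rewrite !mxE mulrA.
rewrite exchange_big; apply: eq_bigr => l _; rewrite mulr_sumr.
by apply: eq_bigr => k _; rewrite mxE.
Qed.

Definition quad_approx f (H : 'M[R]_n) eta (e rho : R) :=
  forall h, `|h| < rho ->
  `|f (eta + h) - f eta - dot (grad f eta) h - 2^-1 * quad H h h|
    <= e * `|h| ^+ 2.

(** The Hessian is taken at [x0] and the gradient at the moving point [x], which
    makes the formula uniform in [x].  Along the segment from [x] to [x + h] the
    derivative of the error at time [s] is
    [dot (grad f (x + s h) - grad f x) h - s Q h], which is small by
    [C1_strict_derivative] applied to each partial derivative. *)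
Lemma taylor2 (U : set 'rV[R]_n) f x0 : nbhs x0 U -> C2_on U f ->
  forall e, 0 < e -> exists2 r, 0 < r & forall x,
    `|x - x0| < r -> quad_approx f (hessian f x0) x e r.
Proof.
move=> Ux0 [fC1 pC1] e e0.
pose e' := e / n.+1%:R; have e'0 : 0 < e' by rewrite divr_gt0.
have : \forall r \near 0^'+, forall l x y,
    `|x - x0| < r -> `|y - x0| < r ->
    `|partial f l y - partial f l x - dot (grad (partial f l) x0) (y - x)|
      <= e' * `|y - x|.
  apply: filter_forall => l.
  have [r r0 rP] := C1_strict_derivative Ux0 (pC1 l) e'0.
  near=> s => x y xs ys; apply: rP; [apply: lt_trans xs _|apply: lt_trans ys _];
    near: s; exact: nbhs_right_lt.
have /nbhs_normP[r1 r10 r1P] : \forall z \near x0, nbhs z U.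
  exact: nbhs_interior.
move=> rP.
have {rP} : \forall r \near 0^'+, 0 < r /\ r < r1 /\ forall l x y,
    `|x - x0| < r -> `|y - x0| < r ->
    `|partial f l y - partial f l x - dot (grad (partial f l) x0) (y - x)|
      <= e' * `|y - x|.
  apply: filterI; first exact: nbhs_right_gt.
  by apply: filterI => //; exact: nbhs_right_lt.
move=> /filter_ex[r [r0 [rr1 rP]]].
exists (r / 2); first by rewrite divr_gt0.
move=> x xr h hr; set H := hessian f x0.
have sr (s : R) : `|s| <= 1 -> `|x + s *: h - x0| < r.
  move=> s1; rewrite addrAC (splitr r); apply: le_lt_trans (ler_normD _ _) _.
  by apply: ltrD => //; apply: le_lt_trans hr; rewrite normrZ ler_piMl.
pose c := dot (grad f x) h; pose q := 2^-1 * quad H h h.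
pose g : R -> R := (fun s => f (x + s *: h)) - (c \*: id) - (q \*: (id ^+ 2)).
pose dg (s : R) := dot (grad f (x + s *: h)) h - c - s * quad H h h.
have gE s : `|s| <= `|1 : R| -> is_derive s (1 : R) g (dg s).
  rewrite normr1 => /sr shr.
  have fD : is_derive s (1 : R) (fun s => f (x + s *: h))
      (dot (grad f (x + s *: h)) h).
    apply: is_derive_line; apply: C1_is_derive fC1.
    by apply: r1P; rewrite /= distrC (lt_trans shr).
  apply: is_derive_eq; rewrite /dg /q /= expr1 ![_ *: (1 : R)]mulr1.
  congr (_ - _); rewrite [LHS](_ : _ = 2^-1 * quad H h h * (2 * s)) //.
  by field.
have dgP s : `|s| <= `|1 : R| -> `|dg s - 0| <= e * `|h| ^+ 2.
  rewrite normr1 subr0 => s1; rewrite /dg /c /H quad_hessianE mulr_sumr.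
  rewrite -!sumrB; apply: le_trans (ler_norm_sum _ _ _) _.
  apply: (@le_trans _ _ (\sum_(l < n) `|h| * (e' * `|h|))); last first.
    rewrite sumr_const card_ord mulrCA -expr2 -mulrnAl ler_wpM2r ?sqr_ge0 //.
    rewrite -mulr_natr /e' -mulrA ger_pMr // mulrC ler_pdivrMr // mul1r.
    by rewrite ler_nat.
  apply: ler_sum => l _; rewrite !mxE.
  have -> : partial f l (x + s *: h) * h 0 l - partial f l x * h 0 l -
      s * (h 0 l * dot (grad (partial f l) x0) h) =
      h 0 l * (partial f l (x + s *: h) - partial f l x -
      dot (grad (partial f l) x0) (s *: h)) by rewrite dotZr; ring.
  rewrite normrM ler_pM // ?coord_le_norm //.
  have := rP l x (x + s *: h); rewrite [x + _ - x]addrC addKr => P.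
  apply: le_trans (P _ (sr _ s1)) _.
    by apply: lt_trans xr _; rewrite ltr_pdivrMr // ltr_pMr // ltr1n.
  by rewrite ler_pM2l // normrZ ler_piMl.
have := mvt_affine gE dgP; rewrite normr1 mul0r subr0 mulr1.
apply: le_trans; rewrite le_eqVlt; apply/orP; left; apply/eqP; congr `|_|.
rewrite /g !fctE /= scale1r scale0r addr0 /c /q.
rewrite scaler0 [_%:A]mulr1 expr1n expr0n /= scaler0 [_ *: (1 : R)]mulr1.
by rewrite !subr0; ring.
Unshelve. all: by end_near.
Qed.

End SecondOrder.

(** * The curvature inequality in a plane *)

Section Geometry.
Context {R : realType} {n : nat}.
Implicit Types (x y h u v g eta xi : 'rV[R]_n) (f : 'rV[R]_n -> R).
Implicit Types (F : set 'rV[R]_n) (H : 'M[R]_n).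

(** With [h = a g + b u], this bounds, up to the factor [|a| |h|], the defect of
    homogeneity [Q h |u|^2 - Q u |h|^2], see [plane_curvature_ineq].  It is a
    rational expression so that its continuity is immediate: where
    [1 / |g|] and [|u|] would be sharp, the larger [1 + 1 / |g|^2] and
    [1 + |u|^2] appear. *)
Definition mix_term H g u : R :=
  `|quad H g g * dot u u - quad H u u * dot g g| * (1 + (dot g g)^-1) +
  (1 + dot u u) * `|quad H g u + quad H u g|.

(** The lower bound for [Chat / r^2].  At [eta = xi], [r = 0] and [e = 0] it
    is the value [Q u / (2 D |u|^2)] of the lower limit. *)
Definition curvature_bound H e D r g u : R :=
  (2^-1 * quad H u u - e * dot u u) /
  (D * (dot u u + r * mix_term H g u / (2 * dot g g))).

Lemma mix_term_ge0 H g u : 0 <= mix_term H g u.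
Proof.
apply: addr_ge0; rewrite mulr_ge0 // addr_ge0 ?invr_ge0 ?dot_ge0 //.
Qed.

(** The sharp bounds are [|a| <= r / sqrt c] and [|a| c <= r sqrt c]; both
    [1 / sqrt c <= 1 + 1 / c] and [sqrt c <= 1 + c] hold. *)
Lemma norm_le_of_sqr (a r c : R) : 0 < c -> 0 <= r -> a ^+ 2 * c <= r ^+ 2 ->
  `|a| <= r * (1 + c^-1) /\ `|a| * c <= r * (1 + c).
Proof.
move=> c0 r0 ac; have c'0 : 0 < c^-1 by rewrite invr_gt0.
have nn (p q : R) : 0 <= p -> 0 <= q -> p ^+ 2 <= q ^+ 2 -> p <= q.
  by move=> p0 q0; rewrite ler_pXn2r.
have rc : 0 <= r * (1 + c) by rewrite mulr_ge0 // addr_ge0 // ltW.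
have rc' : 0 <= r * (1 + c^-1) by rewrite mulr_ge0 // addr_ge0 // ltW.
split; [apply: nn => //|apply: nn => //; first by rewrite mulr_ge0 // ltW].
  rewrite real_normK ?num_real // -(ler_pM2r c0); apply: le_trans ac _.
  rewrite exprMn -mulrA ler_peMr ?sqr_ge0 //.
  rewrite [leRHS](_ : _ = c + 2 + c^-1); last by field; rewrite gt_eqF.
  by move: (c^-1) c'0 => d; lra.
rewrite exprMn real_normK ?num_real // exprMn expr2 mulrA.
apply: le_trans (ler_wpM2r (ltW c0) ac) _.
rewrite ler_wpM2l ?sqr_ge0 // sqrrD expr1n mul1r.
rewrite [leRHS](_ : _ = c + (1 + c + c ^+ 2)); last by ring.
by rewrite lerDl !addr_ge0 ?sqr_ge0 // ltW.
Qed.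

(** Since [u] and [g] are orthogonal, the part of [Q h |u|^2 - Q u |h|^2] that
    is quadratic in [b] cancels, so that a factor [a] remains.  As
    [T = - a |g|^2], this defect is [T] times something of order [r], and it is
    absorbed on the side of [T]. *)
Lemma plane_curvature_ineq H (g u h : 'rV[R]_n) (a b e r T : R) :
  dot u g = 0 -> 0 < dot u u -> 0 < dot g g ->
  h = a *: g + b *: u -> 0 <= r -> r ^+ 2 = dot h h ->
  T = - dot g h -> 0 <= T -> 2^-1 * quad H h h - e * r ^+ 2 <= T ->
  (2^-1 * quad H u u - e * dot u u) * r ^+ 2 <=
  T * (dot u u + r * mix_term H g u / (2 * dot g g)).
Proof.
move=> ug u0 g0 hE r0 rE TE T0 QT.
set U := dot u u; set G := dot g g.
have TaG : T = - (a * G).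
  by rewrite TE hE dotDr !dotZr (dotC g u) ug mulr0 addr0.
have rUG : r ^+ 2 = a ^+ 2 * G + b ^+ 2 * U.
  rewrite rE hE !dotDl !dotDr !dotZl !dotZr ug (dotC g u) ug -/U -/G; ring.
have [aG _] : `|a| <= r * (1 + G^-1) /\ `|a| * G <= r * (1 + G).
  by apply: norm_le_of_sqr => //; rewrite rUG lerDl mulr_ge0 ?sqr_ge0 // ltW.
have [_ bU] : `|b| <= r * (1 + U^-1) /\ `|b| * U <= r * (1 + U).
  by apply: norm_le_of_sqr => //; rewrite rUG lerDr mulr_ge0 ?sqr_ge0 // ltW.
have a0 : a <= 0 by rewrite -(pmulr_lle0 _ g0) -oppr_ge0 -TaG.
have QE : quad H h h * U - quad H u u * r ^+ 2 =
    a * (a * (quad H g g * U - quad H u u * G) +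
         b * U * (quad H g u + quad H u g)).
  rewrite rUG hE !quadDl !quadDr !quadZl !quadZr; ring.
have QB : quad H u u * r ^+ 2 - `|a| * (r * mix_term H g u) <= quad H h h * U.
  rewrite lerBlDr -lerBlDl -normrN.
  apply: (le_trans (ler_norm _)); rewrite distrC QE normrM normrN.
  rewrite ler_wpM2l //; apply: le_trans (ler_normD _ _) _.
  rewrite !normrM (ger0_norm (ltW u0)) /mix_term mulrDr lerD //.
    by rewrite mulrCA [leLHS]mulrC ler_wpM2l.
  by rewrite mulrA ler_wpM2r.
have aE : `|a| = T / G by rewrite TaG ler0_norm // mulNr mulfK ?gt_eqF.
rewrite [leRHS](_ : _ = T * U + 2^-1 * (T / G * (r * mix_term H g u)));
  last first.
  by field; rewrite gt_eqF.
rewrite -lerBlDr -aE.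
apply: (@le_trans _ _ ((2^-1 * quad H h h - e * r ^+ 2) * U)); last first.
  by rewrite ler_wpM2r // ltW.
have := ler_wpM2l (_ : 0 <= 2^-1) QB; rewrite invr_ge0 => /(_ (ler0n _ _)).
lra.
Qed.

End Geometry.

(** * The lower bound at nearby boundary points *)

Section Curvature.
Context {R : realType} {n : nat}.
Implicit Types (x y h u v g eta xi : 'rV[R]_n) (f : 'rV[R]_n -> R).
Implicit Types (F : set 'rV[R]_n) (H : 'M[R]_n).

Lemma convex_segment F x y (t : R) :
  convex_set (F : set (convex_lmodType 'rV[R]_n)) ->
  F x -> F y -> 0 <= t -> t <= 1 -> F (x + t *: (y - x)).
Proof.
move=> cF Fx Fy t0 t1.
have := cF y x (Itv01 t0 t1); rewrite !inE => /(_ Fy Fx).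
rewrite [X in F X -> _](_ : _ = t *: y + (1 - t) *: x) //.
by rewrite scalerBl scale1r scalerBr addrCA.
Qed.

Lemma planeP f eta u y : plane f eta u y ->
  exists a b, y - eta = a *: grad f eta + b *: u.
Proof.
rewrite /plane /= span_cons span_seq1 => /memv_addP[_ /vlineP[a ->]].
by move=> [_ /vlineP[b ->] ->]; exists a, b.
Qed.

Lemma plane_comb f eta u a b :
  plane f eta u (eta + (a *: grad f eta + b *: u)).
Proof.
rewrite /plane /= addrC addKr span_cons span_seq1.
by apply: memv_add; apply: memvZ; exact: memv_line.
Qed.

(** The gradient is an outer normal of [F] at [eta]: along the segment from
    [eta] to [y], which stays in [F], the function [f] starts at [0] and remains
    nonpositive, so that its first order term is nonpositive. *)
Lemma supporting F f H eta e rho y :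
  convex_set (F : set (convex_lmodType 'rV[R]_n)) ->
  F `<=` [set x | f x <= 0] -> F eta -> f eta = 0 ->
  0 < rho -> quad_approx f H eta e rho ->
  F y -> dot (grad f eta) (y - eta) <= 0.
Proof.
move=> cF Ff Feta f0 rho0 T Fy; set h := y - eta; set p := dot _ _.
rewrite leNgt; apply/negP => p0.
(* [M] bounds the second order terms, and any [t < p / M] gives a contradiction
   once the point at time [t] is within reach of the approximation. *)
pose M := `|2^-1 * quad H h h| + `|e| * `|h| ^+ 2 + 1.
have M0 : 0 < M by rewrite ltr_wpDl // addr_ge0 // mulr_ge0 ?sqr_ge0.
have : \forall t \near (0 : R)^'+,
    0 < t /\ t < 1 /\ t < rho / (`|h| + 1) /\ t < p / M.
  have h0 : 0 < `|h| + 1 by rewrite ltr_wpDl.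
  apply: filterI; first exact: nbhs_right_gt.
  apply: filterI; first exact: nbhs_right_lt.
  by apply: filterI; apply: nbhs_right_lt; rewrite divr_gt0.
move=> /filter_ex[t [t0 [t1 [tr tp]]]].
have Fyt : F (eta + t *: h) by apply: convex_segment => //; exact: ltW.
have htr : `|t *: h| < rho.
  rewrite normrZ gtr0_norm //; move: tr; rewrite ltr_pdivlMr ?ltr_wpDl //.
  by apply: le_lt_trans; rewrite ler_pM2l // lerDl.
have := T _ htr; rewrite f0 subr0 dotZr -/p quadZl quadZr normrZ gtr0_norm //.
rewrite ler_norml => /andP[lo _].
have ft : f (eta + t *: h) <= 0 by exact: Ff.
move: tp; rewrite ltr_pdivlMr //; apply/negP; rewrite -leNgt.
have Q1 := ler_norm (- (2^-1 * quad H h h)); rewrite normrN in Q1.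
have e1 : e * `|h| ^+ 2 <= `|e| * `|h| ^+ 2.
  by rewrite ler_wpM2r ?sqr_ge0 // ler_norm.
rewrite -(ler_pM2l t0).
have K : t ^+ 2 * (- (2^-1 * quad H h h) + e * `|h| ^+ 2) <= t ^+ 2 * M.
  rewrite ler_wpM2l ?sqr_ge0 // /M; lra.
have -> : t * (t * M) = t ^+ 2 * M by ring.
apply: le_trans K; lra.
Qed.

Lemma dot_star f eta y :
  dot (eta - y) (star f eta) =
  - dot (grad f eta) (y - eta) / dot eta (grad f eta).
Proof.
by rewrite /star dotZr mulrC -(opprB y) -scaleN1r dotZl mulN1r (dotC (y - _)).
Qed.

(** A competitor [y] is moved towards [eta] until its distance is exactly [r],
    where [plane_curvature_ineq] applies; by convexity it stays in [F], and by
    [supporting] the quantity to be minimized can only decrease. *)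
Lemma Chat_ge F f H eta u e rho r :
  convex_set (F : set (convex_lmodType 'rV[R]_n)) ->
  F `<=` [set x | f x <= 0] -> F eta -> f eta = 0 ->
  quad_approx f H eta e rho -> 0 <= e -> 0 < r -> r < rho ->
  dot u (grad f eta) = 0 -> 0 < dot u u -> 0 < dot eta (grad f eta) ->
  0 < dot (grad f eta) (grad f eta) ->
  ((curvature_bound H e (dot eta (grad f eta)) r (grad f eta) u * r ^+ 2)%:E
    <= Chat F f r eta u)%E.
Proof.
move=> cF Ff Feta f0 T e0 r0 rrho ug u0 D0 g0.
have rho0 := lt_trans r0 rrho.
apply: le_ereal_inf_tmp => _ [y [Fy /planeP[a [b hE]] ry] <-].
rewrite lee_fin dot_star.
set g := grad f eta in ug D0 g0 hE *; set D := dot eta g in D0 *.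
have yN : enorm (y - eta) = enorm (eta - y) by rewrite -enormN opprB.
have y0 : 0 < enorm (eta - y) := lt_le_trans r0 ry.
pose t := r / enorm (eta - y).
have t0 : 0 < t by rewrite divr_gt0.
have t1 : t <= 1 by rewrite ler_pdivrMr // mul1r.
set h := y - eta in hE yN *.
have rE : enorm (t *: h) = r by rewrite enormZ gtr0_norm // yN mulfVK ?gt_eqF.
have Fth : F (eta + t *: h) by apply: convex_segment => //; exact: ltW.
have s0 : 0 <= - dot g h by rewrite oppr_ge0; exact: supporting T Fy.
have Tge0 : 0 <= - dot g (t *: h) by rewrite dotZr -mulrN mulr_ge0 // ltW.
have Tle : - dot g (t *: h) <= - dot g h.
  by rewrite dotZr -mulrN ler_piMl.
have thr : `|t *: h| <= r by rewrite -[leRHS]rE norm_le_enorm.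
have QT : 2^-1 * quad H (t *: h) (t *: h) - e * r ^+ 2 <= - dot g (t *: h).
  have := T _ (le_lt_trans thr rrho); rewrite f0 subr0 ler_norml => /andP[lo _].
  have ft : f (eta + t *: h) <= 0 by exact: Ff.
  have : e * `|t *: h| ^+ 2 <= e * r ^+ 2.
    by rewrite ler_wpM2l // ler_pXn2r ?nnegrE // ltW.
  by rewrite -/g in lo; lra.
have thE : t *: h = (t * a) *: g + (t * b) *: u.
  by rewrite hE scalerDr !scalerA.
have rE2 : r ^+ 2 = dot (t *: h) (t *: h) by rewrite -sqr_enorm rE.
have C := plane_curvature_ineq ug u0 g0 thE (ltW r0) rE2 erefl Tge0 QT.
have K0 : 0 < dot u u + r * mix_term H g u / (2 * dot g g).
  rewrite ltr_wpDr // divr_ge0 ?mulr_ge0 ?mix_term_ge0 ?dot_ge0 //; exact: ltW.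
rewrite /curvature_bound; move: K0 C; set X := dot u u + _ => K0 C.
rewrite mulrAC ler_pdivrMr ?mulr_gt0 //.
rewrite [leRHS](_ : _ = - dot g h * X); last by field; rewrite gt_eqF.
by apply: le_trans C _; rewrite ler_wpM2r // ltW.
Qed.

End Curvature.

(** * The upper bound at the base point *)

Section Upper.
Context {R : realType} {n : nat}.
Implicit Types (x y h u v g eta xi : 'rV[R]_n) (f : 'rV[R]_n -> R).
Implicit Types (F : set 'rV[R]_n) (H : 'M[R]_n).

Definition parabola f xi u (c b : R) :=
  xi + (- (c * b ^+ 2) *: grad f xi + b *: u).

(** The scaling is that of a boundary tangent to [u]: the displacement along
    the gradient is of the order of the square of the one along [u], so that its
    first order effect on [f] competes with the second order effect of [b u]. *)
Lemma parabola_limit f H xi u c :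
  f xi = 0 -> dot u (grad f xi) = 0 ->
  (forall e, 0 < e -> exists2 rho, 0 < rho & quad_approx f H xi e rho) ->
  f (parabola f xi u c b) / b ^+ 2 @[b --> (0 : R)^'+] -->
    2^-1 * quad H u u - c * dot (grad f xi) (grad f xi).
Proof.
move=> f0 ug T; set g := grad f xi in ug *.
apply/cvgrPdistC_le => e e0.
pose M := `|u| + `|c| * `|g| + 1.
have M0 : 0 < M by rewrite ltr_wpDl // addr_ge0 // mulr_ge0.
pose N := `|c| * `|quad H u g + quad H g u| + c ^+ 2 * `|quad H g g| + 1.
have N0 : 0 < N by rewrite ltr_wpDl // addr_ge0 // mulr_ge0 // sqr_ge0.
have e1 : 0 < e / 2 / M ^+ 2 by rewrite !divr_gt0 // exprn_gt0.
have [rho rho0 Tr] := T _ e1.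
near=> b.
have b0 : 0 < b by near: b; exact: nbhs_right_gt.
have b1 : b < 1 by near: b; exact: nbhs_right_lt.
have bM : b * M < rho.
  by rewrite -ltr_pdivlMr //; near: b; apply: nbhs_right_lt; rewrite divr_gt0.
have bN : b * N < e.
  by rewrite -ltr_pdivlMr //; near: b; apply: nbhs_right_lt; rewrite divr_gt0.
pose w := u - (c * b) *: g.
have wM : `|w| <= M.
  apply: le_trans (ler_normB _ _) _; rewrite /M -addrA lerD2l normrZ normrM.
  rewrite ler_wpDr // ler_wpM2r // ler_piMr // gtr0_norm //; exact: ltW.
(* The displacement is [b w] with [w] close to [u], so both the error and the
   form [Q] scale with [b^2]. *)
have hE : - (c * b ^+ 2) *: g + b *: u = b *: w.
  by rewrite /w scalerBr scalerA scaleNr addrC; congr (_ - _ *: _); ring.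
have bw : `|b *: w| < rho.
  by rewrite normrZ gtr0_norm //; apply: le_lt_trans bM; rewrite ler_pM2l.
pose P := c ^+ 2 * b ^+ 2 * quad H g g - c * b * (quad H u g + quad H g u).
have QE : quad H w w = quad H u u + P.
  rewrite /w -scaleNr quadDl !quadDr !quadZl !quadZr /P; ring.
have PN : `|P| <= e.
  apply: le_trans (ltW bN); apply: le_trans (ler_normB _ _) _.
  rewrite normrM [`|c ^+ 2 * _|]normrM !(ger0_norm (sqr_ge0 _)).
  rewrite !normrM (gtr0_norm b0) /N.
  set p := `|_ + _|; set q := `|quad H g g|.
  have : b * (c ^+ 2 * (b * q)) <= b * (c ^+ 2 * q).
    rewrite ler_pM2l // ler_wpM2l ?sqr_ge0 //.
    by rewrite ler_piMl ?normr_ge0 // ltW.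
  lra.
have := Tr _ bw; rewrite f0 subr0 dotZr quadZl quadZr QE normrZ gtr0_norm //.
have -> : dot (grad f xi) w = - (c * b * dot g g).
  by rewrite dotC /w dotBl dotZl ug sub0r.
move=> Tb; rewrite /parabola hE.
have w2 : e / 2 / M ^+ 2 * (b * `|w|) ^+ 2 <= e / 2 * b ^+ 2.
  rewrite exprMn mulrCA mulrC ler_wpM2r ?sqr_ge0 //.
  rewrite -[leRHS](divfK (_ : M ^+ 2 != 0)) ?gt_eqF ?exprn_gt0 //.
  rewrite ler_wpM2l ?(ltW e1) // ler_pXn2r ?nnegrE ?(ltW M0) //.
have {w2} Tb := le_trans Tb w2.
have b2 : 0 < b ^+ 2 by rewrite exprn_gt0.
rewrite [X in `|X|](_ : _ =
  (f (xi + b *: w) - b * - (c * b * dot g g) -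
   2^-1 * (b * (b * (quad H u u + P)))) / b ^+ 2 + 2^-1 * P); last first.
  by field; rewrite gt_eqF.
apply: le_trans (ler_normD _ _) _.
rewrite normrM normfV (gtr0_norm b2) (splitr e) lerD //.
  by rewrite ler_pdivrMr.
by rewrite normrM gtr0_norm ?invr_gt0 // mulrC ler_wpM2r // invr_ge0.
Unshelve. all: by end_near.
Qed.

(** The competitor is a boundary point on the parabolas through [xi], found by
    the intermediate value theorem in the parameter [c]: this replaces a local
    parametrization of the boundary by the implicit function theorem. *)
Lemma Chat_le F f H (U : set 'rV[R]_n) xi u (e : R) :
  (forall x, boundary F x -> F x) -> nbhs xi U ->
  (forall x, U x -> {for x, continuous f}) ->
  (forall x, U x -> f x = 0 -> boundary F x) ->
  f xi = 0 -> dot u (grad f xi) = 0 ->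
  (forall e, 0 < e -> exists2 rho, 0 < rho & quad_approx f H xi e rho) ->
  0 < dot (grad f xi) (grad f xi) -> 0 < dot xi (grad f xi) -> 0 < e ->
  \forall b \near (0 : R)^'+,
    (Chat F f (b * enorm u) xi u <=
     (b ^+ 2 * ((2^-1 * quad H u u + e) / dot xi (grad f xi)))%:E)%E.
Proof.
move=> bF Uxi cf fbF f0 ug T g0 D0 e0.
set g := grad f xi in ug g0 D0 *; set G := dot g g in g0 *.
set D := dot xi g in D0 *; set q := 2^-1 * quad H u u.
(* On either side of the critical value [q / G], where the limit in
   [parabola_limit] vanishes. *)
pose c1 := (q - e) / G; pose c2 := (q + e) / G.
have c12 : c1 <= c2 by rewrite ler_pM2r ?invr_gt0 //; lra.
have [rho /= rho0 rhoU] := (nbhs_normP _ _).1 Uxi.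
pose M := (`|c1| + `|c2|) * `|g| + `|u| + 1.
have M0 : 0 < M by rewrite ltr_wpDl // addr_ge0 // mulr_ge0 // addr_ge0.
have L1 : \forall b \near (0 : R)^'+, 0 < f (parabola f xi u c1 b) / b ^+ 2.
  have := cvgr_gt _ (parabola_limit (c := c1) f0 ug T) 0; apply.
  by rewrite -/q -/g -/G divfK ?gt_eqF //; lra.
have L2 : \forall b \near (0 : R)^'+, f (parabola f xi u c2 b) / b ^+ 2 < 0.
  have := cvgr_lt _ (parabola_limit (c := c2) f0 ug T) 0; apply.
  by rewrite -/q -/g -/G divfK ?gt_eqF //; lra.
near=> b.
have b0 : 0 < b by near: b; exact: nbhs_right_gt.
have b1 : b < 1 by near: b; exact: nbhs_right_lt.
have bM : b * M < rho.
  by rewrite -ltr_pdivlMr //; near: b; apply: nbhs_right_lt; rewrite divr_gt0.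
have b2 : 0 < b ^+ 2 by rewrite exprn_gt0.
have F1 : 0 < f (parabola f xi u c1 b).
  have : 0 < f (parabola f xi u c1 b) / b ^+ 2 by near: b.
  by rewrite pmulr_lgt0 // invr_gt0.
have F2 : f (parabola f xi u c2 b) < 0.
  have : f (parabola f xi u c2 b) / b ^+ 2 < 0 by near: b.
  by rewrite pmulr_llt0 // invr_gt0.
have inU c : c \in `[c1, c2] -> U (parabola f xi u c b).
  rewrite in_itv /= => /andP[c1c cc2].
  apply: rhoU; rewrite /= /parabola opprD addNKr normrN.
  apply: le_lt_trans bM; apply: le_trans (ler_normD _ _) _.
  rewrite !normrZ normrN normrM normrX (gtr0_norm b0) -/g.
  have cc : `|c| <= `|c1| + `|c2|.
    rewrite ler_norml; apply/andP; split.
      by have := ler_norm (- c1); rewrite normrN; have := normr_ge0 c2; lra.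
    by have := ler_norm c2; have := normr_ge0 c1; lra.
  have : `|c| * b ^+ 2 * `|g| <= b * ((`|c1| + `|c2|) * `|g|).
    rewrite [leRHS]mulrA ler_wpM2r // [leRHS]mulrC ler_pM ?sqr_ge0 //.
    by rewrite expr2 ler_piMl // ltW.
  by rewrite /M; lra.
have [||c cI fc0] := @IVT R (fun c => f (parabola f xi u c b)) c1 c2 0 c12.
- apply: continuous_in_subspaceT => c; rewrite inE => /inU Uc.
  apply: (@continuous_comp _ _ _ (fun c => parabola f xi u c b) f).
    apply: cvgD; first exact: cvg_cst.
    apply: cvgD; last exact: cvg_cst.
    by apply: cvgZr_tmp; apply: cvgN; apply: cvgMr_tmp; exact: cvg_id.
  exact: cf.
- by rewrite ge_min le_max (ltW F1) (ltW F2) orbT.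
have /bF Fy : boundary F (parabola f xi u c b) by apply: fbF => //; exact: inU.
move: cI; rewrite in_itv /= => /andP[_ cc2].
apply: (@le_trans _ _
    (dot (xi - parabola f xi u c b) (star f xi))%:E); last first.
  rewrite lee_fin dot_star -/g -/D.
  rewrite /parabola addrC addKr dotDr !dotZr (dotC g u) ug mulr0 addr0 -/g -/G.
  rewrite [leLHS](_ : _ = b ^+ 2 * (c * G / D)); last by ring.
  by rewrite ler_pM2l // ler_pM2r ?invr_gt0 // -ler_pdivlMr.
apply: ereal_inf_lbound; exists (parabola f xi u c b) => //; split => //.
  exact: plane_comb.
rewrite -[xi - _]opprB enormN /parabola [_ - xi]addrC addKr.
rewrite -(ger0_norm (mulr_ge0 (ltW b0) (enorm_ge0 u))) -sqrtr_sqr.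
rewrite ler_wsqrtr // exprMn sqr_enorm.
rewrite !dotDl !dotDr !dotZl !dotZr ug (dotC g u) ug.
set G' := dot (grad f xi) (grad f xi).
rewrite [leRHS](_ : _ = b ^+ 2 * dot u u + (c * b ^+ 2) ^+ 2 * G');
  last by ring.
by rewrite lerDl mulr_ge0 ?sqr_ge0 // dot_ge0.
Unshelve. all: by end_near.
Qed.

End Upper.

(** * Dependence on the boundary point *)

(** Instance resolution does not see through the topology of row vectors. *)
#[local] Instance nbhs_row_filter (R : realType) n (xi : 'rV[R]_n) :
  Filter (nbhs xi) := nbhs_filter xi.

Section Limits.
Context {R : realType} {n : nat}.
Implicit Types (x y h u v g eta xi : 'rV[R]_n) (f : 'rV[R]_n -> R).
Implicit Types (F : set 'rV[R]_n) (H : 'M[R]_n).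

Lemma cvg_quad H (T : Type) (G : set_system T) {FG : Filter G}
    (p q : T -> 'rV[R]_n) u v :
  (forall k, p x 0 k @[x --> G] --> u 0 k) ->
  (forall k, q x 0 k @[x --> G] --> v 0 k) ->
  quad H (p x) (q x) @[x --> G] --> quad H u v.
Proof.
move=> pu qv; apply: cvg_dot => // k; rewrite mxE; under eq_fun do rewrite mxE.
by apply: cvg_sum => l; apply: cvgMr_tmp.
Qed.

Lemma cvg_curvature_bound H e (T : Type) (G : set_system T) {FG : Filter G}
    (D r : T -> R) (p q : T -> 'rV[R]_n) D0 g u :
  D x @[x --> G] --> D0 -> r x @[x --> G] --> 0 ->
  (forall k, p x 0 k @[x --> G] --> g 0 k) ->
  (forall k, q x 0 k @[x --> G] --> u 0 k) ->
  D0 != 0 -> dot g g != 0 -> dot u u != 0 ->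
  curvature_bound H e (D x) (r x) (p x) (q x) @[x --> G] -->
    (2^-1 * quad H u u - e * dot u u) / (D0 * dot u u).
Proof.
move=> cD cr cp cq D00 g0 u0.
have -> : D0 * dot u u =
    D0 * (dot u u + 0 * mix_term H g u / (2 * dot g g)).
  by rewrite mul0r mul0r addr0.
have Qpp := cvg_quad (FG := FG) (H := H) cp cp.
have Qqq := cvg_quad (FG := FG) (H := H) cq cq.
have Qpq := cvg_quad (FG := FG) (H := H) cp cq.
have Qqp := cvg_quad (FG := FG) (H := H) cq cp.
have cgg := cvg_dot (FG := FG) cp cp; have cuu := cvg_dot (FG := FG) cq cq.
have cmix : mix_term H (p x) (q x) @[x --> G] --> mix_term H g u.
  apply: cvgD; apply: cvgM.
  - by apply: cvg_norm; apply: cvgB; apply: cvgM.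
  - by apply: cvgD; [exact: cvg_cst|exact: cvgV].
  - by apply: cvgD; [exact: cvg_cst|].
  - by apply: cvg_norm; apply: cvgD.
have c2g : (2 * dot (p x) (p x))^-1 @[x --> G] --> (2 * dot g g)^-1.
  have c2 : 2 * dot (p x) (p x) @[x --> G] --> 2 * dot g g.
    exact: cvgMl_tmp.
  by apply: (cvgV _ c2); rewrite mulf_neq0.
have cden : D x * (dot (q x) (q x) + r x * mix_term H (p x) (q x) /
      (2 * dot (p x) (p x))) @[x --> G] -->
    D0 * (dot u u + 0 * mix_term H g u / (2 * dot g g)).
  by apply: cvgM => //; apply: cvgD => //; apply: cvgM => //; exact: cvgM.
apply: cvgM; first by apply: cvgB; apply: cvgMl_tmp.
by apply: (cvgV _ cden); rewrite mul0r mul0r addr0 mulf_neq0.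
Qed.

Lemma uvec_perp f i j eta : j != i -> partial f i eta != 0 ->
  dot (uvec f i j eta) (grad f eta) = 0.
Proof.
move=> ji fi; rewrite /dot (bigD1 j) //= (bigD1 i) 1?eq_sym //= big1.
  by rewrite !mxE eqxx (eq_sym i) (negPf ji) eqxx; field.
by move=> k /andP[kj ki]; rewrite !mxE (negPf kj) (negPf ki) mul0r.
Qed.

Lemma uvec_gt0 f i j eta : 0 < dot (uvec f i j eta) (uvec f i j eta).
Proof.
apply: lt_le_trans (sqr_coord_le_dot _ j).
by rewrite mxE eqxx expr1n.
Qed.

Lemma grad_gt0 f i eta : partial f i eta != 0 ->
  0 < dot (grad f eta) (grad f eta).
Proof.
move=> fi; apply: lt_le_trans (sqr_coord_le_dot _ i).
by rewrite mxE exprn_even_gt0.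
Qed.

Lemma cvg_uvec f i j xi : partial f i xi != 0 ->
  (forall k, {for xi, continuous (partial f k)}) ->
  forall k, uvec f i j x 0 k @[x --> xi] --> uvec f i j xi 0 k.
Proof.
move=> fi cf k; rewrite mxE; under eq_fun do rewrite mxE.
have cst (c : R) : (fun=> c) x @[x --> xi] --> c.
  exact: cvg_cst.
case: (k == j); first exact: cst.
case: (k == i); last exact: cst.
by apply: cvgN; apply: cvgM; [exact: cf|exact: (cvgV fi (cf i))].
Qed.

Lemma cvg_grad f xi : (forall k, {for xi, continuous (partial f k)}) ->
  forall k, grad f x 0 k @[x --> xi] --> grad f xi 0 k.
Proof.
by move=> cf k; rewrite mxE; under eq_fun do rewrite mxE; exact: cf.
Qed.

End Limits.

(** * The lower limit *)

Theorem theorem1 (R : realType) (n : nat) (hn : (2 <= n)%N)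
    (F : set 'rV[R]_n) (cptF : compact F)
    (cvxF : convex_set (F : set (convex_lmodType 'rV[R]_n)))
    (F0 : interior F 0)
    (xi : 'rV[R]_n) (bxi : boundary F xi)
    (delta : R) (delta0 : 0 < delta)
    (f : 'rV[R]_n -> R) (fC2 : C2_on (eball xi delta) f)
    (Ff : F `<=` [set x | f x <= 0])
    (xif : 0 < dot xi (grad f xi))
    (bFf : forall x, eball xi delta x -> (boundary F x <-> f x = 0))
    (i : 'I_n) (fi : partial f i xi != 0)
    (firsti : forall k : 'I_n, (k < i)%N -> partial f k xi = 0)
    (j : 'I_n) (ji : j != i) :
  gammahat F f i j xi =
  ((2 * dot xi (grad f xi) * enorm (uvec f i j xi) ^+ 2)^-1 *
   dot (uvec f i j xi *m (hessian f xi)^T) (uvec f i j xi))%:E.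
Proof.
have Uxi := nbhs_eball xi delta0.
have [_ cpf] := fC2.1 _ (nbhs_singleton Uxi).
have {}cpf k : {for xi, continuous (partial f k)} := (cpf k).2.
have bFF x : boundary F x -> F x.
  by case=> + _; apply: compact_closed => //; exact: norm_hausdorff.
have f0 : f xi = 0 by apply/bFf => //; exact: nbhs_singleton Uxi.
have g0 := grad_gt0 fi; have u0 := uvec_gt0 f i j xi.
have ug := uvec_perp ji fi.
have cu := cvg_uvec (j := j) fi cpf; have cg := cvg_grad cpf.
set H := hessian f xi.
rewrite -/(quad H _ _) sqr_enorm /gammahat.
set u := uvec f i j xi in u0 ug cu *; set D := dot xi (grad f xi) in xif *.
rewrite limf_einfE; apply/eqP; rewrite eq_le; apply/andP; split.
  apply: ge_ereal_sup => _ [A FA <-]; apply/lee_addgt0Pr => e e0.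
  (* This factor turns the error of [Chat_le] into [e] after the division by
     [D] and by [r^2 = b^2 |u|^2]. *)
  have {}e0 : 0 < e * (D * dot u u) by rewrite !mulr_gt0.
  have T e' : 0 < e' -> exists2 rho, 0 < rho & quad_approx f H xi e' rho.
    move=> /(taylor2 Uxi fC2)[rho rho0 rhoP]; exists rho => //.
    by apply: rhoP; rewrite subrr normr0.
  have L := Chat_le bFF Uxi (fun x Ux => (fC2.1 _ Ux).1)
    (fun x Ux => (bFf x Ux).2) f0 ug T g0 xif e0.
  have eu0 : 0 < enorm u by rewrite sqrtr_gt0.
  case: FA => -[P Q] /= [P0 Qxi] PQA.
  have : \forall b \near (0 : R)^'+, P (b * enorm u).
    have [d /= d0 dP] := (nbhs_normP _ _).1 P0.
    near=> b; have b0 : 0 < b by near: b; exact: nbhs_right_gt.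
    have bu : 0 < b * enorm u by rewrite mulr_gt0.
    apply: dP => //=; rewrite sub0r normrN gtr0_norm // -ltr_pdivlMr //.
    by near: b; apply: nbhs_right_lt; rewrite divr_gt0.
  move=> /(filterI L)/(filterI (nbhs_right_gt (0 : R)))/filter_ex.
  move=> [b [/= b0 [Lb Pb]]].
  apply: (@le_trans _ _
      (Chat F f (b * enorm u) xi u / ((b * enorm u) ^+ 2)%:E)%E); last first.
    have r0 : 0 < (b * enorm u) ^+ 2 by rewrite exprn_gt0 ?mulr_gt0.
    rewrite inver gt_eqF // lee_pdivrMr //.
    rewrite -EFinD -EFinM; apply: le_trans Lb _; rewrite lee_fin.
    rewrite exprMn sqr_enorm le_eqVlt; apply/orP; left; apply/eqP.
    by rewrite -/D -/u; field; rewrite !gt_eqF.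
  apply: ereal_inf_lbound; exists (b * enorm u, xi) => //.
  by apply: PQA; split => //=; move/nbhs_singleton: Qxi; apply.
apply/lee_subgt0Pr => e e0.
(* With this error term [curvature_bound] tends to the limit minus [e / 2],
   which leaves [e / 2] for the variation of [r] and [eta]. *)
have e'0 : 0 < e * D / 2 by rewrite divr_gt0 // mulr_gt0.
have [rho rho0 T] := taylor2 Uxi fC2 e'0.
pose W := within (boundary F) (nbhs xi).
pose FP := filter_prod (0 : R)^'+ W.
have FFP : Filter FP by exact: filter_prod_filter.
have near2 (P : 'rV[R]_n -> Prop) : nbhs xi P -> \forall p \near FP, P p.2.
  move=> xP; exists (setT, P) => /=; last by case=> r x [].
  by split; [exact: filterT|exact: cvg_within xP].
have cvg2 (phi : 'rV[R]_n -> R) : phi x @[x --> xi] --> phi xi ->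
    phi p.2 @[p --> FP] --> phi xi.
  by move=> phix A /phix; exact: near2.
have cD : dot x (grad f x) @[x --> xi] --> D.
  by apply: cvg_dot => // k; exact: cvg_coord.
have cL : curvature_bound H (e * D / 2) (dot p.2 (grad f p.2)) p.1 (grad f p.2)
    (uvec f i j p.2) @[p --> FP] -->
    (2^-1 * quad H u u - e * D / 2 * dot u u) / (D * dot u u).
  apply: cvg_curvature_bound => //; try by rewrite gt_eqF.
  - exact: (cvg2 (fun x => dot x (grad f x))).
  - move=> A A0; exists (A, setT) => /=; last by case=> r x [].
    by split; [exact: cvg_within A0|exact: filterT].
  - by move=> k; exact: (cvg2 (fun x => grad f x 0 k)).
  - by move=> k; exact: (cvg2 (fun x => uvec f i j x 0 k)).
  - by rewrite gt_eqF.
have r1 : \forall p \near FP, 0 < p.1 < rho.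
  exists ([set r | 0 < r < rho], setT) => /=; last by case=> r x [].
  split; last exact: filterT.
  near=> r; apply/andP; split; near: r; first exact: nbhs_right_gt.
  exact: nbhs_right_lt.
have N1 : \forall p \near FP, boundary F p.2.
  exists (setT, boundary F) => /=; last by case=> r x [].
  by split; [exact: filterT|exact: withinT].
have N2 : \forall p \near FP, eball xi delta p.2 by exact: near2.
have N3 : \forall p \near FP, `|p.2 - xi| < rho.
  apply: (near2 (fun x => `|x - xi| < rho)).
  have := (nbhs_normP xi (fun x => `|x - xi| < rho)).2; apply.
  by exists rho => //= x; rewrite /ball_ /= distrC.
have N4 : \forall p \near FP, partial f i p.2 != 0.
  exact: (near2 (fun x => partial f i x != 0) (cvgr_neq0 _ (cpf i) fi)).
have N5 : \forall p \near FP, 0 < dot p.2 (grad f p.2).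
  exact: (cvgr_gt _ (cvg2 _ cD)).
have N6 : \forall p \near FP, (2 * D * dot u u)^-1 * quad H u u - e <
    curvature_bound H (e * D / 2) (dot p.2 (grad f p.2)) p.1 (grad f p.2)
    (uvec f i j p.2).
  have := cvgr_gt _ cL; apply.
  rewrite [ltRHS](_ : _ = (2 * D * dot u u)^-1 * quad H u u - e / 2).
    by rewrite ltrD2l ltrN2 ltr_pdivrMr // ltr_pMr // ltr1n.
  by field; rewrite !gt_eqF.
have : \forall p \near FP,
    (((2 * D * dot u u)^-1 * quad H u u - e)%:E <=
    Chat F f p.1 p.2 (uvec f i j p.2) / (p.1 ^+ 2)%:E)%E.
  near=> p.
  have /andP[p0 prho] : 0 < p.1 < rho by near: p.
  have bp : boundary F p.2 by near: p.
  have fp : partial f i p.2 != 0 by near: p.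
  have r20 : 0 < p.1 ^+ 2 by rewrite exprn_gt0.
  rewrite inver gt_eqF // lee_pdivlMr //.
  have Tp : quad_approx f H p.2 (e * D / 2) rho.
    by apply: T; near: p.
  apply: le_trans (Chat_ge cvxF Ff (bFF _ bp) _ Tp (ltW e'0) p0 prho
    (uvec_perp ji fp) (uvec_gt0 f i j _) _ (grad_gt0 fp)); last 2 first.
  - by apply/bFf => //; near: p.
  - by near: p.
  rewrite -EFinM lee_fin ler_pM2r // ltW //; near: p; exact: N6.
move=> N; pose A := [set p : R * 'rV[R]_n |
    (((2 * D * dot u u)^-1 * quad H u u - e)%:E <=
    Chat F f p.1 p.2 (uvec f i j p.2) / (p.1 ^+ 2)%:E)%E].
set h := fun p : R * 'rV[R]_n => (_ / _)%E.
apply: (@le_trans _ _ (ereal_inf (h @` A))); last first.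
  by apply: ereal_sup_ubound; exists A.
by apply: le_ereal_inf_tmp => _ [p /= pP <-].
Unshelve. all: by end_near.
Qed.
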